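(* Let $G$ be a simple $3$-connected graph. Operations D1, D2, and D3 can be expressed as a sequence of edge additions and vertex splits. Specifically: (a) D1 applied to a vertex $x$ and an edge $ab$ in $G$ to create a new edge $xy$ (where $y$ is the new vertex subdividing $ab$) can be expressed as $(G+e)\circ f$, where $e=xa$ and $f=ay$; (b) D2 applied to two edges $ab$ and $cd$ in $G$ to create a new edge $xy$ (where $x$ and $y$ are the new vertices subdividing $ab$ and $cd$, respectively) can be expressed as $(G+e)\circ\{f_c,f_b\}$, where $e=bc$, $f_b=xb$ and $f_c=cy$; (c) D3 applied to vertices $x$, $y$ and $z$ in $G$ to create a new vertex $w$ and edges $xw$, $yw$ and $zw$ can be expressed as $(G+\{e_1,e_2\})\circ f$, where $e_1=yx$, $e_2=zx$ and $f=xw$.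
   Context: Graphs are finite and not necessarily simple unless stated. Operation D1 (bridging a vertex and an edge): given an edge $ab$ and a vertex $x\neq a,b$, subdivide $ab$ by a new vertex $y$ and add the edge $xy$. Operation D2 (bridging two edges): given two distinct edges $ab$ and $cd$ (possibly adjacent), subdivide $ab$ by a new vertex $x$ and $cd$ by a new vertex $y$, and add the edge $xy$; the endpoints are named so that $b\neq c$. Operation D3 (adding a degree 3 vertex): given three distinct vertices $x,y,z$, add a new vertex $w$ and the three edges $xw,yw,zw$. Edge addition: $G+uv$ (or $G+e$ with $e=uv$) is the graph obtained from $G$ by adding a new edge $e$ between the distinct vertices $u$ and $v$; in this statement the added edge is allowed to be parallel to an existing edge. $G+\{e_1,e_2\}$ means both edges are added. Vertex split: let $v$ be a vertex of degree at least $4$. Divide the neighbors of $v$ (when parallel edges are present, the edges incident to $v$) into two disjoint parts $S$ and $T$, each of size at least $2$. Replace $v$ by two distinct vertices $v$ and $v'$, join them by a new edge $f=vv'$, join each neighbor in $S$ to $v$ and each neighbor in $T$ to $v'$. The result is denoted $G\circ_{S,T} f$, or simply $G\circ f$, where it is understood that the split is performed with some particular assignment of the neighbors (incident edges) of $v$ to $v$ and $v'$; here $v'$ is regarded as the new vertex and $f=vv'$ as the new edge. Thus in (a), vertex $a$ is split with new vertex $y$; in (c), vertex $x$ is split with new vertex $w$. $H\circ\{f_c,f_b\}$ means two successive vertex splits: in (b), first $c$ is split with new vertex $y$ and new edge $f_c=cy$, and then $b$ is split with new vertex $x$ and new edge $f_b=xb$. ''Can be expressed as'' means that for a suitable assignment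 in each split the resulting graph is the graph produced by the operation. *)

(* Defs.v *)
From mathcomp Require Import all_boot.

Set Implicit Arguments.
Unset Strict Implicit.
Unset Printing Implicit Defensive.

(* Finite graphs with named edges: parallel edges are distinct edges with the
   same set of ends, and a loop is an edge whose set of ends is a singleton. *)
Record mgraph := MGraph {
  vert : finType;
  edge : finType;
  ends : edge -> {set vert};
  card_ends : forall e, 0 < #|ends e| <= 2 }.

Definition simple_graph (G : mgraph) : Prop :=
  (forall e : edge G, #|ends e| = 2) /\ injective (@ends G).

Definition edges_at (G : mgraph) (v : vert G) : {set edge G} :=
  [set e | v \in ends e].

(* Loops count twice. *)
Definition degree (G : mgraph) (v : vert G) : nat :=
  #|edges_at v| + #|[set e : edge G | ends e == [set v]]|.

Definition adjacent (G : mgraph) : rel (vert G) :=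
  fun u v => [exists e : edge G, ends e == [set u; v]].

Definition connected_off (G : mgraph) (X : {set vert G}) : Prop :=
  forall u v, u \notin X -> v \notin X ->
    connect (fun s t => [&& s \notin X, t \notin X & adjacent s t]) u v.

Definition k_connected (k : nat) (G : mgraph) : Prop :=
  k < #|vert G| /\
  forall X : {set vert G}, #|X| < k -> connected_off X.

Lemma card_set2_ends (V : finType) (u v : V) : 0 < #|[set u; v]| <= 2.
Proof. by rewrite cards2; case: (u != v). Qed.

Lemma card_imset_ends (V W : finType) (h : V -> W) (A : {set V}) :
  0 < #|A| <= 2 -> 0 < #|h @: A| <= 2.
Proof.
case/andP=> A_gt0 A_le2; rewrite (leq_trans (leq_imset_card _ _) A_le2) andbT.
by case/card_gt0P: A_gt0 => u uA; apply/card_gt0P; exists (h u); rewrite imset_f.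
Qed.

(* In all the constructions below, [Some] embeds the old vertices (edges) and
   [None] is the new vertex (edge). *)

(* Used for distinct [u] and [v]. *)
Section AddEdge.
Variables (G : mgraph) (u v : vert G).

Definition add_edge_ends (o : option (edge G)) : {set vert G} :=
  if o is Some e then ends e else [set u; v].

Lemma add_edge_endsP o : 0 < #|add_edge_ends o| <= 2.
Proof. by case: o => [e|]; [exact: card_ends | exact: card_set2_ends]. Qed.

Definition add_edge : mgraph := MGraph add_edge_endsP.
End AddEdge.

Section AddVertex.
Variable G : mgraph.

Definition add_vertex_ends (e : edge G) : {set option (vert G)} :=
  Some @: ends e.

Lemma add_vertex_endsP e : 0 < #|add_vertex_ends e| <= 2.
Proof. exact/card_imset_ends/card_ends. Qed.

Definition add_vertex : mgraph := MGraph add_vertex_endsP.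
End AddVertex.

(* Meaningful when [ends e = [set a; b]]. With [y] the new vertex, [e] is
   replaced by two edges: [ay], which takes over the name [Some e], and [yb],
   which is named [None]. *)
Section Subdivide.
Variables (G : mgraph) (e : edge G) (a b : vert G).

Definition subdivide_ends (o : option (edge G)) : {set option (vert G)} :=
  if o is Some e' then
    if e' == e then [set Some a; None] else Some @: ends e'
  else [set None; Some b].

Lemma subdivide_endsP o : 0 < #|subdivide_ends o| <= 2.
Proof.
case: o => [e'|] /=; last exact: card_set2_ends.
case: ifP => _; first exact: card_set2_ends.
exact/card_imset_ends/card_ends.
Qed.

Definition subdivide : mgraph := MGraph subdivide_endsP.
End Subdivide.

Definition split_parts (G : mgraph) (v : vert G) (S T : {set edge G}) : Prop :=
  [/\ 4 <= degree v, S :|: T = edges_at v, [disjoint S & T],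
      2 <= #|S| & 2 <= #|T|].

(* The graph obtained by splitting [v] when [split_parts v S T] holds: [None]
   is the new vertex, and also the new edge joining it to [v]. The edges in [T]
   are moved to the new vertex, and those in [S] stay at [v], so that [S] need
   not be mentioned. *)
Section VertexSplit.
Variables (G : mgraph) (v : vert G) (T : {set edge G}).

Definition vertex_split_ends (o : option (edge G)) : {set option (vert G)} :=
  if o is Some e then
    [set (if (u == v) && (e \in T) then None else Some u) | u in ends e]
  else [set Some v; None].

Lemma vertex_split_endsP o : 0 < #|vertex_split_ends o| <= 2.
Proof.
case: o => [e|]; last exact: card_set2_ends.
exact/card_imset_ends/card_ends.
Qed.

Definition vertex_split : mgraph := MGraph vertex_split_endsP.
End VertexSplit.

(* The new vertex is [None]. *)
Definition bridge_vertex_edge (G : mgraph) (x : vert G)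
    (e : edge G) (a b : vert G) : mgraph :=
  @add_edge (subdivide e a b) (Some x) None.

(* The old vertices are the [Some (Some v)]; the vertex subdividing [e1 = ab]
   is [Some None] and the one subdividing [e2 = cd] is [None]. *)
Definition bridge_edges (G : mgraph) (e1 : edge G) (a b : vert G)
    (e2 : edge G) (c d : vert G) : mgraph :=
  @add_edge (@subdivide (subdivide e1 a b) (Some e2) (Some c) (Some d))
    (Some None) None.

(* The new vertex is [None]. *)
Definition add_degree3_vertex (G : mgraph) (x y z : vert G) : mgraph :=
  let G1 := @add_edge (add_vertex G) (Some x) None in
  let G2 := @add_edge G1 (Some y) None in
  @add_edge G2 (Some z) None.

(* [h] is the vertex part of an isomorphism from [G] to [H]. *)
Definition iso_by (G H : mgraph) (h : vert G -> vert H) : Prop :=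
  bijective h /\
  exists2 g : edge G -> edge H,
    bijective g & forall e, ends (g e) = h @: ends e.

(* Main.v *)
Require Import Defs.
From mathcomp Require Import all_boot.

(** A vertex split is undone by contracting its new edge, so the splits are
    found by contracting. In D1, contract [ay]: the half [yb] of the subdivided
    edge becomes [ab] again, and [xy] becomes an edge [xa]; so splitting [a] in
    [G + xa] with [ab] and [xa] moved to the new vertex [y] gives D1 back. In D2,
    contract [cy] and [xb]: the edge [xy] becomes [bc], so [c] is split moving
    [cd] and [bc], and then [b] is split moving [ab] and the edge that used to be
    [bc]. In D3, contract [xw]: the edges [yw] and [zw] become [yx] and [zx],
    which are the two edges moved when [x] is split.

    In each split two edges are moved, so what is left to check is that the
    split vertex has at least four incident edges, two of which then remain
    ([split_parts_move2]). This is where connectivity enters: in a loopless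
    [k]-connected graph every vertex has at least [k] incident edges, since
    otherwise its neighbourhood would separate it from another vertex
    ([k_connected_edges_at]); with [k = 3], an added edge provides the fourth.

    The graphs to be compared then have the same vertices, up to exchanging the
    names of the two new ones in D2, and their edges differ in names only: a
    split gives the name of its new edge to the half of the subdivided edge at
    the split vertex (in D3, to [xw]), whichever name that half got from the
    subdivision. The isomorphisms are therefore explicit permutations of a few
    edge names ([bridge_vertex_edge_split], [bridge_edges_split],
    [add_degree3_vertex_split]). *)

Set Implicit Arguments.
Unset Strict Implicit.
Unset Printing Implicit Defensive.

(** * Degrees *)

(** The neighbours of [v] are at most as many as the edges at [v]. If there
    were fewer than [k], some vertex would be neither [v] nor a neighbour of
    [v], and removing the neighbours would separate it from [v]. *)
Lemma k_connected_edges_at (k : nat) (G : mgraph) (v : vert G) :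
  (forall e : edge G, #|ends e| = 2) -> k_connected k G -> k <= #|edges_at v|.
Proof.
move=> loopless [ltkG conn]; rewrite leqNgt; apply/negP => lt_deg.
pose X := [set u | adjacent v u].
have le_X : #|X| <= #|edges_at v|.
  (* A neighbour [u] is determined by the set of ends [{v, u}] of an edge. *)
  have inj : {in X &, injective (fun u => [set v; u])}.
    move=> u u' _ _ eq_vu.
    have := set22 v u; rewrite eq_vu in_set2 => /orP[/eqP uv|/eqP //].
    by have := set22 v u'; rewrite -eq_vu uv in_set2 orbb => /eqP.
  rewrite -(card_in_imset inj) (leq_trans _ (leq_imset_card (@ends G) _)) //.
  apply/subset_leq_card/subsetP => A /imsetP[u].
  rewrite inE => /existsP[e /eqP ends_e] ->.
  by apply/imsetP; exists e; rewrite ?inE ends_e ?set21.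
have vX : v \notin X.
  rewrite inE; apply/existsP => -[e /eqP ends_e].
  by have := loopless e; rewrite ends_e setUid cards1.
have ltXk : #|X| < k by apply: leq_ltn_trans lt_deg.
have [u] : exists u, u \notin v |: X.
  apply/existsP; rewrite -negb_forall; apply/negP => /forallP all_in.
  have : #|vert G| <= #|v |: X| by apply/subset_leq_card/subsetP => u _.
  by rewrite leqNgt cardsU1 vX (leq_ltn_trans _ ltkG).
rewrite in_setU1 negb_or => /andP[u_v uX].
have /connectP[[|t p] /= path_p last_p] := conn X ltXk v u vX uX.
  by rewrite last_p eqxx in u_v.
by case/andP: path_p => /and3P[_ tX adj] _; rewrite inE adj in tX.
Qed.

Lemma edges_at_add_edge (G : mgraph) (s t u : vert G) :
  #|edges_at u| <= #|@edges_at (add_edge s t) u|.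
Proof.
rewrite -(card_imset _ (@Some_inj _)).
by apply/subset_leq_card/subsetP => _ /imsetP[e /[!inE] ue ->].
Qed.

Lemma edges_at_add_edge_end (G : mgraph) (s t u : vert G) :
  u \in [set s; t] -> #|edges_at u| < #|@edges_at (add_edge s t) u|.
Proof.
move=> u_st; rewrite -(card_imset _ (@Some_inj _)).
apply/proper_card/properP; split.
  by apply/subsetP => _ /imsetP[e /[!inE] ue ->].
by exists None; [rewrite inE | apply/imsetP => -[]].
Qed.

Lemma edges_at_vertex_split (G : mgraph) (v u : vert G) (T : {set edge G}) :
  u != v -> #|edges_at u| <= #|@edges_at (vertex_split v T) (Some u)|.
Proof.
move=> uv; rewrite -(card_imset _ (@Some_inj _)).
apply/subset_leq_card/subsetP => _ /imsetP[e /[!inE] ue ->] /=.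
by apply/imsetP; exists u => //; rewrite (negPf uv).
Qed.

(** * Vertex splits *)

Lemma imset_pair (U V : finType) (h : U -> V) (p q : U) :
  h @: [set p; q] = [set h p; h q].
Proof. by rewrite imsetU1 imset_set1. Qed.

(** Moving exactly two edges makes the bound of four incident edges the only
    requirement on the split vertex: two edges remain at it. *)
Lemma split_parts_move2 (G : mgraph) (v : vert G) (e f : edge G) :
  e != f -> v \in ends e -> v \in ends f -> 4 <= #|edges_at v| ->
  split_parts v (edges_at v :\: [set e; f]) [set e; f].
Proof.
move=> ef ve vf deg.
have sub : [set e; f] \subset edges_at v by rewrite subUset !sub1set !inE ve.
split.
- exact: leq_trans deg (leq_addr _ _).
- by rewrite setUC -{1}(setIidPr sub) setID.
- by rewrite disjoint_sym disjoints_subset setDE setCI setCK subsetUr.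
- by rewrite cardsDS // cards2 ef leq_subRL // ltnW // ltnW.
- by rewrite cards2 ef.
Qed.

Lemma vertex_split_ends_stay (G : mgraph) (v : vert G) (T : {set edge G})
    (e : edge G) :
  e \notin T -> @ends (vertex_split v T) (Some e) = Some @: ends e.
Proof. by move=> eT; apply: eq_imset => u; rewrite (negPf eT) andbF. Qed.

Lemma vertex_split_ends_move (G : mgraph) (v u : vert G) (T : {set edge G})
    (e : edge G) :
  e \in T -> ends e = [set u; v] -> u != v ->
  @ends (vertex_split v T) (Some e) = [set Some u; None].
Proof.
by move=> eT /= ->; rewrite imset_pair eqxx eT => /negPf ->.
Qed.

(** * The three operations *)

(** The edge [xa] becomes [xy] and [ab] becomes [yb], while the new edge of the
    split is [ay]. *)
Lemma bridge_vertex_edge_split (G : mgraph) (ab : edge G) (a b x : vert G) :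
  ends ab = [set a; b] -> a != b -> x != a ->
  @iso_by (bridge_vertex_edge x ab a b)
    (@vertex_split (add_edge x a) a [set Some ab; None]) (fun u => u).
Proof.
move=> ends_ab a_b x_a; split; first by exists id.
pose g (o : option (option (edge G))) : option (option (edge G)) :=
  match o with
  | None => Some None
  | Some None => Some (Some ab)
  | Some (Some e) => if e == ab then None else o
  end.
have g_inj : injective g.
  by case=> [[e|]|] [[e'|]|] //=; do ?case: eqP => //; congruence.
exists g; first exact: injF_bij.
move=> o; rewrite imset_id; case: o => [[e|]|].
- rewrite /g; have [-> | e_ab] := eqVneq e ab.
    by rewrite /= eqxx.
  rewrite vertex_split_ends_stay; last by rewrite !inE orbF (inj_eq Some_inj).
  by rewrite /= (negPf e_ab).
- rewrite (@vertex_split_ends_move (add_edge x a) a b) ?set21 //=.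
  + by rewrite setUC.
  + by rewrite ends_ab setUC.
  + by rewrite eq_sym.
- by rewrite (@vertex_split_ends_move (add_edge x a) a x) ?set22.
Qed.

(** In D2 the vertex [x] subdividing [ab] is created before the vertex [y]
    subdividing [cd], whereas splitting [c] creates [y] before splitting [b]
    creates [x]; so the names of the two new vertices are exchanged. *)
Definition swap_new_vertices (V : Type) (o : option (option V)) :
    option (option V) :=
  match o with
  | None => Some None
  | Some None => None
  | Some (Some _) => o
  end.

Lemma swap_new_verticesK (V : Type) : involutive (@swap_new_vertices V).
Proof. by case=> [[]|]. Qed.

(** The first split turns [bc] into [by] and [cd] into [yd], with new edge [cy].
    The second turns [by] into [xy] and [ab] into [ax], with new edge [xb]. The
    edges [ab] and [cd] may share an end: the first split leaves [ab] in place
    even if [a = c], and if [b = d] the edge [yd] stays at [b], parallel to [by],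
    when the latter is moved by the second split. *)
Lemma bridge_edges_split (G : mgraph) (ab cd : edge G) (a b c d : vert G) :
  ends ab = [set a; b] -> ends cd = [set c; d] -> a != b -> c != d ->
  ab != cd -> b != c ->
  let H := @vertex_split (add_edge b c) c [set Some cd; None] in
  @iso_by (bridge_edges ab a b cd c d)
    (@vertex_split H (Some b) [set Some (Some ab); Some None])
    (@swap_new_vertices (vert G)).
Proof.
move=> ends_ab ends_cd a_b c_d ab_cd b_c H.
split; first by exists (@swap_new_vertices _); apply: swap_new_verticesK.
pose g (o : option (option (option (edge G)))) :
    option (option (option (edge G))) :=
  match o with
  | None => Some (Some None)
  | Some None => Some (Some (Some cd))
  | Some (Some None) => None
  | Some (Some (Some e)) => if e == cd then Some None else o
  end.
have g_inj : injective g.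
  by case=> [[[e|]|]|] [[[e'|]|]|] //=; do ?case: eqP => //; congruence.
have H_cd : @ends H (Some (Some cd)) = [set Some d; None].
  by apply: vertex_split_ends_move; rewrite ?set21 //= 1?setUC // eq_sym.
have H_bc : @ends H (Some None) = [set Some b; None].
  by apply: vertex_split_ends_move; rewrite ?set22.
have H_e e : e != cd -> @ends H (Some (Some e)) = Some @: ends e.
  move=> e_cd; apply: vertex_split_ends_stay.
  by rewrite !inE orbF (inj_eq Some_inj).
exists g; first exact: injF_bij.
case=> [[[e|]|]|].
- rewrite /g; have [-> | e_cd] := eqVneq e cd.
    by rewrite vertex_split_ends_stay /= ?inE //= eqxx !imset_pair.
  have [-> | e_ab] := eqVneq e ab.
    rewrite (@vertex_split_ends_move H (Some b) (Some a)) ?set21 //.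
    + by rewrite /= (inj_eq Some_inj) (negPf ab_cd) eqxx !imset_pair.
    + by rewrite H_e // ends_ab imset_pair.
  rewrite vertex_split_ends_stay ?H_e //; last first.
    by rewrite !inE orbF !(inj_eq Some_inj).
  rewrite /= (inj_eq Some_inj) (negPf e_cd) (negPf e_ab) -!imset_comp.
  exact: eq_imset.
- by rewrite /= imset_pair /= imset_pair setUC.
- rewrite vertex_split_ends_stay ?H_cd; last first.
    by rewrite !inE orbF !(inj_eq Some_inj) eq_sym.
  by rewrite /= !imset_pair setUC.
- rewrite (@vertex_split_ends_move H (Some b) None) ?set22 ?H_bc 1?setUC //.
  by rewrite /= imset_pair setUC.
Qed.

(** Moving [yx] and [zx] to the new vertex [w] yields [yw] and [zw], and the
    third edge [xw] at [w] is the new edge of the split. *)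
Lemma add_degree3_vertex_split (G : mgraph) (x y z : vert G) :
  y != x -> z != x ->
  let H := @add_edge (add_edge y x) z x in
  @iso_by (add_degree3_vertex x y z)
    (@vertex_split H x [set Some None; None]) (fun u => u).
Proof.
move=> y_x z_x H; split; first by exists id.
pose g (o : option (option (option (edge G)))) :
    option (option (option (edge G))) :=
  match o with
  | None => Some None
  | Some None => Some (Some None)
  | Some (Some None) => None
  | Some (Some (Some e)) => o
  end.
have g_inj : injective g.
  by case=> [[[e|]|]|] [[[e'|]|]|] //=; congruence.
exists g; first exact: injF_bij.
move=> o; rewrite imset_id; case: o => [[[e|]|]|].
- by rewrite vertex_split_ends_stay ?inE.
- by [].
- by rewrite (@vertex_split_ends_move H x y) ?set21.
- by rewrite (@vertex_split_ends_move H x z) ?set22.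
Qed.

Theorem theorem3p1 (G : mgraph) (simpleG : simple_graph G)
    (connG : k_connected 3 G) :
  (forall (ab : edge G) (a b x : vert G),
     ends ab = [set a; b] -> x != a -> x != b ->
     exists S T : {set edge (add_edge x a)},
       @split_parts (add_edge x a) a S T /\
       @iso_by (bridge_vertex_edge x ab a b)
               (@vertex_split (add_edge x a) a T)
               (fun u => u))
  /\
  (forall (ab cd : edge G) (a b c d : vert G),
     ends ab = [set a; b] -> ends cd = [set c; d] -> ab != cd -> b != c ->
     exists S1 T1 : {set edge (add_edge b c)},
       @split_parts (add_edge b c) c S1 T1 /\
       let H := @vertex_split (add_edge b c) c T1 in
       exists S2 T2 : {set edge H},
         @split_parts H (Some b) S2 T2 /\
         exists h : vert (bridge_edges ab a b cd c d) ->
                    vert (@vertex_split H (Some b) T2),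
           [/\ iso_by h,
               forall v : vert G, h (Some (Some v)) = Some (Some v),
               h (Some None) = None
             & h None = Some None])
  /\
  (forall x y z : vert G,
     x != y -> x != z -> y != z ->
     let H := @add_edge (add_edge y x) z x in
     exists S T : {set edge H},
       @split_parts H x S T /\
       @iso_by (add_degree3_vertex x y z) (@vertex_split H x T)
               (fun u => u)).
Proof.
have [loopless _] := simpleG.
have deg (v : vert G) : 3 <= #|edges_at v|
  by exact: k_connected_edges_at v loopless connG.
have ends_neq (e : edge G) u v : ends e = [set u; v] -> u != v.
  by move=> ends_e; have := loopless e; rewrite ends_e cards2; case: eqP.
split; [|split].
- move=> ab a b x ends_ab x_a _.
  exists (@edges_at (add_edge x a) a :\: [set Some ab; None]).
  exists [set Some ab; None].
  split; last exact: bridge_vertex_edge_split (ends_neq _ _ _ ends_ab) _.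
  apply: split_parts_move2; rewrite //= ?ends_ab ?set21 ?set22 //.
  by apply: leq_ltn_trans (deg a) (edges_at_add_edge_end _); rewrite set22.
- move=> ab cd a b c d ends_ab ends_cd ab_cd b_c.
  exists (@edges_at (add_edge b c) c :\: [set Some cd; None]).
  exists [set Some cd; None].
  split.
    apply: split_parts_move2; rewrite //= ?ends_cd ?set21 ?set22 //.
    by apply: leq_ltn_trans (deg c) (edges_at_add_edge_end _); rewrite set22.
  move=> H.
  exists (edges_at (Some b : vert H) :\: [set Some (Some ab); Some None]).
  exists [set Some (Some ab); Some None]; split.
    apply: split_parts_move2 => //=.
    + by apply/imsetP; exists b; rewrite ?ends_ab ?set22 // (negPf b_c).
    + by apply/imsetP; exists b; rewrite ?set21 // (negPf b_c).
    + apply: leq_trans (@edges_at_vertex_split (add_edge b c) c b _ b_c).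
      by apply: leq_ltn_trans (deg b) (edges_at_add_edge_end _); rewrite set21.
  exists (@swap_new_vertices (vert G)); split=> //.
  apply: bridge_edges_split => //.
    exact: ends_neq ends_ab.
  exact: ends_neq ends_cd.
- move=> x y z x_y x_z _ H.
  exists (edges_at (x : vert H) :\: [set Some None; None]).
  exists [set Some None; None].
  split; last by apply: add_degree3_vertex_split; rewrite eq_sym.
  apply: split_parts_move2; rewrite //= ?set22 //.
  apply: leq_trans (@edges_at_add_edge (add_edge y x) z x x).
  by apply: leq_ltn_trans (deg x) (edges_at_add_edge_end _); rewrite set22.
Qed.
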